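(* In the generalized low-rank linear bandit model, suppose we feed $\{(X_s,y_s)\}_{s=1}^t$ into an online prediction algorithm which, for all $t\ge0$, admits a regret under negative log-likelihood loss $\sup_{\|\Theta\|_F\le1}\rho_t^{\mathrm{GLB}}(\Theta)\le B_t$. Let $\hat y_s$ be the prediction at time step $s$ by the online learner. Then, for any $\delta\in(0,0.25]$, $$\mathbb{P}\left(\exists t\in\mathbb{N}\text{ such that }\Theta^*\notin\mathcal{C}_t\right)\le\delta,$$ where $$\mathcal{C}_t=\left\{\Theta\in\mathbb{R}^{d_1\times d_2}:\|\Theta\|_F^2+\sum_{s=1}^t(\hat y_s-\langle\Theta,X_s\rangle)^2\le\beta_t^{\mathrm{GLB}}(\delta)\right\},$$ $$\beta_t^{\mathrm{GLB}}(\delta)=2+\frac4{\kappa_\mu}B_t+\frac{32R^2}{\kappa_\mu^2}\log\left(\frac{R\sqrt{\frac8{\kappa_\mu^2}}+\sqrt{\frac2{\kappa_\mu}B_t+1}}{\delta}\right).$$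
   Context: $\langle A,B\rangle=\mathrm{trace}(A^TB)$, $\|\cdot\|_F$ is the Frobenius norm. Model: $\Theta^*\in\mathbb{R}^{d_1\times d_2}$ is unknown with $\|\Theta^*\|_F\le1$ (and of rank $r\ll\min\{d_1,d_2\}$). In round $t$ an arm $X_t\in\mathbb{R}^{d_1\times d_2}$ with $\|X_t\|_F\le1$ is chosen based on the past and $y_t=\mu(\langle X_t,\Theta^*\rangle)+\eta_t$ is observed, where $\mathbb{E}[y_t|X_t,\Theta^*]=\mu(\langle X_t,\Theta^*\rangle)$ and $\eta_t$ is conditionally $R$-sub-Gaussian given $X_t$ and $\{(X_s,\eta_s)\}_{s=1}^{t-1}$. The reward follows an exponential family $\mathbb{P}(y|z=\langle X,\Theta^*\rangle)=\exp\left(\frac{yz-m(z)}{\phi(\tau)}+h(y,\tau)\right)$ with known $\tau>0$ and known $m,\phi,h$, $m$ strictly convex, and the link is $\mu=m'$. There are constants $L_\mu,c_\mu\ge0$, $\kappa_\mu>0$ such that $\mu$ is $L_\mu$-Lipschitz on $[-1,1]$, continuously differentiable on $(-1,1)$, $\inf_{z\in(-1,1)}\mu'(z)=\kappa_\mu$ and $|\mu(0)|\le c_\mu$. An online prediction algorithm in round $s$ receives $X_s$, outputs a prediction $\hat y_s$ based on $X_s$ and $\{(X_u,y_u)\}_{u<s}$, then observes $y_s$. The negative log-likelihood loss is $\ell_s(z)=-zy_s+m(z)$, and $\rho_t^{\mathrm{GLB}}(\Theta)=\sum_{s=1}^t\left[\ell_s(\hat y_s)-\ell_s(\langle\Thet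a,X_s\rangle)\right]$.
   Formalization: The formal theorem additionally assumes that the online learner's predictions ŷ_s lie in [-1,1], the interval on which μ' ≥ κ_μ is assumed; without this the claim fails (logistic model, X_s=0, constant large prediction). *)

(* Defs.v *)
From HB Require Import structures.
From mathcomp Require Export all_boot all_order all_algebra.
From mathcomp Require Export all_classical all_reals all_analysis.
(* not re-exported by all_analysis; declares the sigma-algebra on [\bar R] *)
From mathcomp Require Export measurable_realfun.

Set Implicit Arguments.
Unset Strict Implicit.
Unset Printing Implicit Defensive.

Export Order.TTheory GRing.Theory Num.Theory.
Export numFieldNormedType.Exports.

#[export] Set Implicit Arguments.
#[export] Unset Strict Implicit.
#[export] Unset Printing Implicit Defensive.

Local Open Scope classical_set_scope.
Local Open Scope ring_scope.

Definition mxdot (R : realType) (d1 d2 : nat) (A B : 'M[R]_(d1, d2)) : R :=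
  \tr (A^T *m B).

Definition frob (R : realType) (d1 d2 : nat) (A : 'M[R]_(d1, d2)) : R :=
  Num.sqrt (mxdot A A).

Definition strictly_convex (R : realType) (m : R -> R) : Prop :=
  forall a b k : R, a != b -> 0 < k -> k < 1 ->
    m (k * a + (1 - k) * b) < k * m a + (1 - k) * m b.

(* In an exponential family, [mu] is the link, [m] the log-partition. *)
Record glm_link (R : realType) (m mu : R -> R) (Lmu cmu kappa : R) : Prop :=
  GlmLink {
    link_convex : strictly_convex m;
    link_deriv : forall z : R, is_derive z (1 : R) m (mu z);
    link_L_ge0 : 0 <= Lmu;
    link_lipschitz : forall a b : R, -1 <= a <= 1 -> -1 <= b <= 1 ->
      `|mu a - mu b| <= Lmu * `|a - b|;
    link_derivable : forall z : R, -1 < z < 1 -> derivable mu z 1;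
    link_C1 : forall z : R, -1 < z < 1 -> {for z, continuous (derive1 mu)};
    link_kappa_gt0 : 0 < kappa;
    link_kappa : inf [set derive1 mu z | z in `]-1, 1[%classic] = kappa;
    link_c_ge0 : 0 <= cmu;
    link_mu0 : `|mu 0| <= cmu }.

Section Sigma_algebras.
Context {R : realType} {d : measure_display} {T : measurableType d}.

(* Sub-sigma-algebras are given by generators: [G] stands for [<<s G>>]. *)
Definition rv_gen (f : T -> R) : set (set T) :=
  preimage_set_system setT f (@measurable _ R).

Definition mx_gen (d1 d2 : nat) (X : T -> 'M[R]_(d1, d2)) : set (set T) :=
  \bigcup_(ij in [set: 'I_d1 * 'I_d2]) rv_gen (fun w => X w ij.1 ij.2).

Definition measurable_wrt (G : set (set T)) (f : T -> R) : Prop :=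
  measurable_fun [set: g_sigma_algebraType G] f.

(* [W] is a version of the conditional expectation of [Z] given [<<s G>>]. *)
Definition is_cond_exp (P : probability T R) (G : set (set T))
    (Z W : T -> \bar R) : Prop :=
  [/\ P.-integrable setT Z,
      P.-integrable setT W,
      measurable_fun [set: g_sigma_algebraType G] W &
      forall A : set T, <<s G >> A ->
        (\int[P]_(w in A) W w = \int[P]_(w in A) Z w)%E].

(* Versions agree almost surely, so asking the bound of one of them is asking
   it of all of them. *)
Definition cond_subgaussian (P : probability T R) (G : set (set T))
    (sg : R) (eta : T -> R) : Prop :=
  forall lam : R, exists2 W : T -> \bar R,
    is_cond_exp P G (fun w => (expR (lam * eta w))%:E) W &
    {ae P, forall w, (W w <= (expR (lam ^+ 2 * sg ^+ 2 / 2))%:E)%E}.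

End Sigma_algebras.

(* Rounds are numbered from 0, so that "the first [t] rounds" are the rounds
   [s < t]. *)
Section Bandit.
Context {R : realType} {d : measure_display} {T : measurableType d}.
Context {d1 d2 : nat}.
Implicit Types (X : nat -> T -> 'M[R]_(d1, d2)) (y eta yhat U : nat -> T -> R).

Definition noise_history X eta (t : nat) : set (set T) :=
  (\bigcup_(s in [set s | (s <= t)%N]) mx_gen (X s)) `|`
  (\bigcup_(s in [set s | (s < t)%N]) rv_gen (eta s)).

Definition obs_history X y (t : nat) : set (set T) :=
  \bigcup_(s in [set s | (s < t)%N]) (mx_gen (X s) `|` rv_gen (y s)).

Definition glm_density (m phi : R -> R) (h : R -> R -> R) (tau z v : R) : R :=
  expR ((v * z - m z) / phi tau + h v tau).

(* [nu] is the measure with respect to which the exponential family has its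
   densities, e.g. the Lebesgue measure or the counting measure on the
   integers. *)
Record glb_model (P : probability T R)
    (nu : {sigma_finite_measure set R -> \bar R})
    (m mu phi : R -> R) (h : R -> R -> R) (tau sg : R)
    (Theta_star : 'M[R]_(d1, d2)) X y eta U : Prop := GlbModel {
  glb_X_meas : forall t i j, measurable_fun setT (fun w => X t w i j);
  glb_y_meas : forall t, measurable_fun setT (y t);
  glb_eta_meas : forall t, measurable_fun setT (eta t);
  glb_U_meas : forall t, measurable_fun setT (U t);
  glb_Theta : frob Theta_star <= 1;
  (* [U s] is the learner's private randomness in round [s]; a policy that
     does not randomize ignores it. *)
  glb_policy : forall t i j, measurable_wrt
    (obs_history X y t `|` (\bigcup_(s in [set s | (s <= t)%N]) rv_gen (U s)))
    (fun w => X t w i j);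
  glb_arm : forall t w, frob (X t w) <= 1;
  glb_reward : forall t w, y t w = mu (mxdot (X t w) Theta_star) + eta t w;
  glb_mean : forall t, is_cond_exp P (mx_gen (X t)) (EFin \o y t)
    (fun w => (mu (mxdot (X t w) Theta_star))%:E);
  glb_noise : forall t,
    cond_subgaussian P (noise_history X eta t) sg (eta t);
  glb_tau : 0 < tau;
  glb_phi : phi tau != 0;
  glb_h : measurable_fun setT (h ^~ tau);
  (* The conditional law of [y t] given [X t] has density
     [glm_density m phi h tau z] at [z = <X t, Theta_star>]. *)
  glb_law : forall t (C : set R), measurable C ->
    is_cond_exp P (mx_gen (X t)) (fun w => (\1_(y t @^-1` C) w)%:E)
      (fun w => \int[nu]_(v in C)
         (glm_density m phi h tau (mxdot (X t w) Theta_star) v)%:E)%E }.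

(* Predictions lie in [-1, 1], the range of [<Theta, X>] over the unit balls
   and the interval on which [mu] is controlled. *)
Record online_predictor X y yhat : Prop := OnlinePredictor {
  pred_meas : forall s,
    measurable_wrt (obs_history X y s `|` mx_gen (X s)) (yhat s);
  pred_range : forall s w, -1 <= yhat s w <= 1 }.

Definition nll (m : R -> R) (v z : R) : R := - z * v + m z.

Definition rho_GLB (m : R -> R) X y yhat (t : nat)
    (Theta : 'M[R]_(d1, d2)) (w : T) : R :=
  \sum_(s < t)
    (nll m (y s w) (yhat s w) - nll m (y s w) (mxdot Theta (X s w))).

Definition beta_GLB (kappa sg : R) (B : nat -> R) (delta : R) (t : nat) : R :=
  2 + 4 / kappa * B t +
  32 * sg ^+ 2 / kappa ^+ 2 *
  ln ((sg * Num.sqrt (8 / kappa ^+ 2) + Num.sqrt (2 / kappa * B t + 1))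
      / delta).

Definition conf_set (kappa sg : R) (B : nat -> R) (delta : R) X yhat
    (t : nat) (w : T) : set 'M[R]_(d1, d2) :=
  [set Theta | frob Theta ^+ 2 +
     \sum_(s < t) (yhat s w - mxdot Theta (X s w)) ^+ 2
     <= beta_GLB kappa sg B delta t].

End Bandit.

(* Main.v *)
(* Write d_s = yhat_s - <X_s, Theta_star>, S_t = sum_{s<t} d_s eta_s and
   V_t = sum_{s<t} d_s^2. Strong convexity of [m] on [-1, 1] turns the regret
   bound against Theta_star into (kappa / 2) V_t <= B_t + S_t. As d_s is
   predictable, exp (l S_t - l^2 sg^2 V_t / 2) is a supermartingale for every
   l; averaging over l ~ N(0, sg^-2) gives the supermartingale
   (1 + V_t)^(-1/2) exp (S_t^2 / (2 sg^2 (1 + V_t))), and Ville's inequality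
   bounds it by 1 / delta for all t at once, outside an event of probability
   at most delta. This reads S_t^2 <= 2 sg^2 (1 + V_t) ln (sqrt (1 + V_t) / delta),
   so 1 + V_t is bounded by a quadratic inequality in sqrt (1 + V_t), up to a
   logarithm, which is then solved. *)
From mathcomp Require Import ring lra.
Require Import Defs.

Local Open Scope classical_set_scope.
Local Open Scope ring_scope.

(** * Frobenius inner product and link function *)

Section Mxdot.
Context {R : realType} {d1 d2 : nat}.
Implicit Types A B : 'M[R]_(d1, d2).

Lemma mxdotE A B : mxdot A B = \sum_j \sum_i A i j * B i j.
Proof.
rewrite /mxdot /mxtrace; apply: eq_bigr => j _; rewrite mxE.
by apply: eq_bigr => i _; rewrite mxE.
Qed.

Lemma mxdotC A B : mxdot A B = mxdot B A.
Proof.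
by rewrite !mxdotE; apply: eq_bigr => j _; apply: eq_bigr => i _; rewrite mulrC.
Qed.

Lemma mxdot_sqr_ge0 A : 0 <= mxdot A A.
Proof.
by rewrite mxdotE; do 2 (apply: sumr_ge0 => ? _); rewrite -expr2 sqr_ge0.
Qed.

Lemma mxdot_le_mean A B : 2 * mxdot A B <= mxdot A A + mxdot B B.
Proof.
rewrite !mxdotE mulr_sumr -big_split /=; apply: ler_sum => j _.
rewrite mulr_sumr -big_split /=; apply: ler_sum => i _.
by have := sqr_ge0 (A i j - B i j); nra.
Qed.

Lemma mxdotNl A B : mxdot (- A) B = - mxdot A B.
Proof. by rewrite /mxdot linearN mulNmx linearN. Qed.

Lemma mxdotNN A : mxdot (- A) (- A) = mxdot A A.
Proof. by rewrite mxdotNl mxdotC mxdotNl opprK. Qed.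

Lemma frob_sqr A : frob A ^+ 2 = mxdot A A.
Proof. by rewrite /frob sqr_sqrtr// mxdot_sqr_ge0. Qed.

Lemma frob_le1_sqr A : frob A <= 1 -> mxdot A A <= 1.
Proof.
by move=> A1; rewrite -frob_sqr; apply: exprn_ile1 => //; exact: sqrtr_ge0.
Qed.

Lemma mxdot_itv1 A B : frob A <= 1 -> frob B <= 1 -> -1 <= mxdot A B <= 1.
Proof.
move=> /frob_le1_sqr A1 /frob_le1_sqr B1.
have := mxdot_le_mean A B; have := mxdot_le_mean (- A) B.
by rewrite mxdotNN mxdotNl; lra.
Qed.

End Mxdot.

(** * Strong convexity of the log-partition function *)

Section Link.
Context {R : realType}.
Variables (m mu : R -> R) (Lmu cmu kappa : R).
Hypothesis hlink : glm_link m mu Lmu cmu kappa.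

Let clamp (x : R) : R := Num.max (-1) (Num.min 1 x).

Let clampP x : [\/ clamp x = -1 /\ x <= -1, clamp x = x /\ -1 <= x <= 1 |
                   clamp x = 1 /\ 1 <= x].
Proof.
rewrite /clamp; have [x1|x1] := leP 1 x.
  by rewrite max_r; [apply: Or33|lra].
by have [x2|x2] := leP (-1) x; [apply: Or32; split|apply: Or31; split]; lra.
Qed.

Let clamp_itv x : -1 <= clamp x <= 1.
Proof. by case: (clampP x) => -[-> ?]; lra. Qed.

Let clamp_id x : -1 <= x <= 1 -> clamp x = x.
Proof. by case: (clampP x) => -[-> ?] ?; lra. Qed.

Let clamp_dist a b : `|clamp a - clamp b| <= `|a - b|.
Proof.
have := ler_norm (a - b); have := ler_norm (- (a - b)); rewrite normrN ler_norml.
by case: (clampP a) => -[-> ?]; case: (clampP b) => -[-> ?]; lra.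
Qed.

(* Clamping the argument to [-1, 1] extends [mu] to a continuous function. *)
Lemma link_clamp_continuous :
  continuous (fun x : R => mu (Num.max (-1) (Num.min 1 x))).
Proof.
move=> x; apply/cvgrPdist_le => /= e e0.
have L0 := link_L_ge0 hlink.
near=> z.
apply: (le_trans (link_lipschitz hlink (clamp_itv x) (clamp_itv z))).
apply: (@le_trans _ _ (Lmu * `|x - z|)).
  by apply: ler_wpM2l => //; exact: clamp_dist.
(* [Lmu] may be 0, hence the radius [e / (Lmu + 1)]. *)
apply: (@le_trans _ _ ((Lmu + 1) * (e / (Lmu + 1)))).
  apply: ler_pM => //; first lra.
  near: z; apply: (@cvgr_dist_le _ _ _ _ _ id x cvg_id).
  by rewrite divr_gt0//; lra.
rewrite mulrC divfK//; lra.
Unshelve. all: by end_near. Qed.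

(** Mean value theorem: the slope of [mu] between [a] and [b] is a value of its derivative inside
    (-1, 1), hence at least the infimum [kappa]. *)
Lemma link_growth a b : -1 <= a -> a <= b -> b <= 1 ->
  kappa * (b - a) <= mu b - mu a.
Proof.
move=> a1; rewrite le_eqVlt => /predU1P[<- _|ab b1].
  by rewrite !subrr mulr0.
have [] := @MVT R mu (derive1 mu) a b ab.
- move=> x; rewrite in_itv /= => /andP[ax xb].
  rewrite derive1E; apply/derivableP; apply: (link_derivable hlink); lra.
(* The end points may be -1 or 1, where no derivative is assumed; continuity there comes from the
   clamped extension, equal to [mu] on [-1, 1]. *)
- apply: (@subspace_eq_continuous _ _ _ (fun x : R => mu (clamp x))).
    move=> x; rewrite inE /= in_itv /= => /andP[ax xb].
    by rewrite /from_subspace /= clamp_id //; lra.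
  exact/continuous_subspaceT/link_clamp_continuous.
move=> c; rewrite in_itv /= => /andP[ac cb] ->.
apply: ler_wpM2r; first lra.
rewrite -(link_kappa hlink); apply: ge_inf; last first.
  by exists c => //=; rewrite in_itv /=; lra.
(* The infimum of a set without lower bound is 0 by convention, which [0 < kappa] excludes. *)
apply: contrapT => nlb; have := link_kappa_gt0 hlink.
by rewrite -(link_kappa hlink) inf_out ?ltxx// => -[].
Qed.

(** Subtracting the quadratic minorant from [m] leaves [g], whose derivative [dg] is nonpositive
    left of [a] and nonnegative right of it on [-1, 1], by [link_growth]. So [g] is smallest at
    [a]. *)
Lemma link_strong_convexity a b : -1 <= a <= 1 -> -1 <= b <= 1 ->
  mu a * (b - a) + kappa / 2 * (b - a) ^+ 2 <= m b - m a.
Proof.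
move=> a1 b1.
pose g z := m z - (mu a * (z - a) + kappa / 2 * (z - a) ^+ 2).
pose dg z := mu z - (mu a + kappa * (z - a)).
have dgE z : is_derive z (1 : R) g (dg z).
  have hm := link_deriv hlink z.
  apply: is_deriveB.
  rewrite /dg.
  by apply: is_derive_eq; rewrite /GRing.scale /=; field.
have cg x y : {within `[x, y], continuous g}.
  apply: continuous_subspaceT => z.
  by apply/differentiable_continuous/derivable1_diffP; case: (dgE z).
rewrite -subr_ge0 (_ : _ - _ = g b - g a); last by rewrite /g; ring.
have [ab|ba] := leP a b.
- have [c cab ->] := MVT_segment ab (fun x _ => dgE x) (cg a b).
  move: cab; rewrite in_itv /= => /andP[ac cb].
  apply: mulr_ge0; last lra.
  by rewrite /dg; have := @link_growth a c; lra.
- have [c cab] := MVT_segment (ltW ba) (fun x _ => dgE x) (cg b a).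
  move: cab; rewrite in_itv /= => /andP[bc ca] E.
  suff: dg c * (a - b) <= 0 by lra.
  apply: mulr_le0_ge0; last lra.
  by rewrite /dg; have := @link_growth c a; lra.
Qed.

End Link.

(** * Scalar inequalities and the Gaussian mixture *)

Section Scalar.
Context {R : realType}.

(* The junk value [Num.sqrt a = 0] for [a < 0] is harmless here. It does occur:
   [a] is [2 / kappa * B t + 1], and [B t] may be negative. *)
Lemma log_self_bounded (a f q delta : R) : 0 <= f -> 1 <= q ->
  0 < delta <= 4^-1 ->
  q ^+ 2 <= a + f * q * Num.sqrt (ln (q / delta)) ->
  q ^+ 2 <= 2 * a + 4 * f ^+ 2 * ln ((f + Num.sqrt a) / delta).
Proof.
move=> f0 q1 /andP[d0 d4] H.
set l := ln (q / delta) in H *; set s := f + Num.sqrt a.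
have qd4 : 4 <= q / delta.
  rewrite ler_pdivlMr//; lra.
have l0 : 0 <= l by apply: ln_ge0; lra.
have a2 : a <= Num.sqrt a ^+ 2.
  have [/sqr_sqrtr -> //|/ltW a0] := leP 0 a.
  by apply: (le_trans a0); exact: sqr_ge0.
have sa0 : 0 <= Num.sqrt a := sqrtr_ge0 a.
(* The cross term is at most [(q^2 + f^2 l) / 2], and half of [q^2] is absorbed on the left. *)
have {}H : q ^+ 2 <= 2 * a + f ^+ 2 * l.
  have := sqr_ge0 (q - f * Num.sqrt l).
  rewrite sqrrB exprMn sqr_sqrtr//; lra.
suff: l <= 4 * ln (s / delta).
  by have := sqr_ge0 f; nra.
(* The logarithm needs a positive argument: [s = 0] would force [f = 0] and [a <= 0], hence
   [q^2 <= 0]. *)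
have s0 : 0 < s.
  rewrite lt_neqAle addr_ge0// andbT eq_sym; apply/eqP => s0.
  have f00 : f = 0 by rewrite /s in s0; lra.
  have sa00 : Num.sqrt a = 0 by rewrite /s in s0; lra.
  by move: H a2; rewrite f00 sa00; nra.
(* Suppose the contrary and let [E] be the fourth root of [q / delta]. Then [s < delta E], which
   with [q^2 <= s^2 (2 + l)] gives [E^6 < 2 + l]. But [delta <= 1/4] gives [E^4 >= 4], so
   [E^6 >= 4 E^2 >= 4 (1 + l / 4)^2 > 2 + l]. *)
rewrite leNgt; apply/negP => ls.
set E := expR (l / 4).
have E1 : 1 + l / 4 <= E := expR_ge1Dx _.
have E4 : E ^+ 4 = q / delta.
  rewrite -expRM_natl (_ : _ * _ = l); last by field.
  by rewrite lnK// posrE; lra.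
have sE : s < delta * E.
  rewrite mulrC -ltr_pdivrMr// -[ltLHS]lnK ?posrE ?divr_gt0// ltr_expR; lra.
have E2 : 2 <= E ^+ 2.
  rewrite -(@ler_pXn2r _ 2)// ?nnegrE ?sqr_ge0// -exprM E4; lra.
have sE2 : s ^+ 2 < delta ^+ 2 * E ^+ 2.
  by rewrite -exprMn ltr_pXn2r// ?nnegrE; lra.
have Hs : q ^+ 2 <= s ^+ 2 * (2 + l).
  apply: (le_trans H); rewrite mulrDr.
  have fs : f ^+ 2 <= s ^+ 2 by rewrite /s; nra.
  have as_ : a <= s ^+ 2 by rewrite /s; nra.
  nra.
have qE : q = delta * E ^+ 4 by rewrite E4 mulrC divfK ?gt_eqF.
have : delta ^+ 2 * E ^+ 8 < delta ^+ 2 * (E ^+ 2 * (2 + l)).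
  rewrite (_ : _ * E ^+ 8 = q ^+ 2); last by rewrite qE; ring.
  apply: (le_lt_trans Hs); rewrite mulrA ltr_pM2r//; lra.
rewrite ltr_pM2l ?exprn_gt0// => K.
have E0 : 0 < E := expR_gt0 _.
have : E ^+ 6 < 2 + l.
  by move: K; rewrite (exprD E 2 6) ltr_pM2l ?exprn_gt0.
have : 4 * E ^+ 2 <= E ^+ 6.
  by rewrite (exprD E 4 2) ler_pM2r ?exprn_gt0// E4.
nra.
Qed.

(** Completing the square in [x]: the integrand is the right-hand side times the density of a normal
    law with mean [S / (sg^2 (1 + V))] and variance [1 / (sg^2 (1 + V))], which integrates to 1. *)
Lemma gaussian_mixture (sg S V : R) : 0 < sg -> 0 <= V ->
  (\int[lebesgue_measure]_x
     (expR (x * S - x ^+ 2 * sg ^+ 2 / 2 * V) * normal_pdf 0 sg^-1 x)%:E =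
   ((Num.sqrt (1 + V))^-1 * expR (S ^+ 2 / (2 * sg ^+ 2 * (1 + V))))%:E)%E.
Proof.
move=> sg0 V0.
have r0 : 0 < Num.sqrt (1 + V) by rewrite sqrtr_gt0; lra.
have rE : Num.sqrt (1 + V) ^+ 2 = 1 + V by rewrite sqr_sqrtr; lra.
set r := Num.sqrt (1 + V) in r0 rE *.
rewrite -rE.
set C := r^-1 * _.
have C0 : 0 <= C by rewrite mulr_ge0 ?expR_ge0// invr_ge0 ltW.
pose s' := (sg * r)^-1; pose c := S / (sg ^+ 2 * r ^+ 2).
under eq_integral => x _.
  rewrite (_ : _ * _ = C * normal_pdf c s' x).
    rewrite EFinM; over.
  rewrite !normal_pdfE ?gt_eqF ?invr_gt0 ?mulr_gt0//.
  rewrite /normal_peak /normal_fun.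
  have -> : Num.sqrt (sg^-1 ^+ 2 * pi *+ 2) = sg^-1 * Num.sqrt (pi *+ 2).
    by rewrite -mulrnAr sqrtrM ?sqr_ge0// sqrtr_sqr gtr0_norm// invr_gt0.
  have -> : Num.sqrt (s' ^+ 2 * pi *+ 2) = s' * Num.sqrt (pi *+ 2).
    rewrite -mulrnAr sqrtrM ?sqr_ge0// sqrtr_sqr gtr0_norm//.
    by rewrite invr_gt0 mulr_gt0.
  have p0 : 0 < Num.sqrt (pi *+ 2) :> R by rewrite sqrtr_gt0 mulrn_wgt0// pi_gt0.
  rewrite [LHS]mulrCA -expRD /C.
  rewrite [RHS](_ : _ = r^-1 * (s' * Num.sqrt (pi *+ 2))^-1 *
    (expR (S ^+ 2 / (2 * sg ^+ 2 * r ^+ 2)) *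
      expR (- (x - c) ^+ 2 / (s' ^+ 2 *+ 2)))); last by ring.
  rewrite -expRD; congr (_ * expR _).
    by rewrite /s'; field; rewrite !gt_eqF.
  have -> : V = r ^+ 2 - 1 by rewrite rE; ring.
  by rewrite /s' /c; field; rewrite !gt_eqF.
rewrite ge0_integralZl//.
- by rewrite integral_normal_pdf mule1.
- by apply/measurable_EFinP; exact: measurable_normal_pdf.
- by move=> x _; rewrite lee_fin normal_pdf_ge0.
Qed.

End Scalar.

(** * Conditional sub-Gaussianity with a random multiplier *)

Section Discretization.
Context {R : realType}.
Implicit Types x : R.

Definition floor_grid (n : nat) x : R :=
  (Num.floor (x * n.+1%:R))%:~R / n.+1%:R.

Lemma floor_grid_le n x : floor_grid n x <= x.
Proof. by rewrite /floor_grid ler_pdivrMr// floor_le. Qed.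

Lemma floor_grid_ge n x : x - n.+1%:R^-1 <= floor_grid n x.
Proof.
rewrite /floor_grid ler_pdivlMr// mulrBl mulVf// lerBlDr.
have /andP[_ /ltW] := floor_itv (x * n.+1%:R).
by rewrite rmorphD.
Qed.

Lemma cvg_floor_grid x : floor_grid n x @[n --> \oo] --> x.
Proof.
apply: (@squeeze_cvgr _ _ _ _ (fun n => x - n.+1%:R^-1) (cst x)).
- by near=> n; rewrite floor_grid_ge floor_grid_le.
- rewrite -[X in _ --> X]subr0; apply: cvgB; first exact: cvg_cst.
  exact: cvg_harmonic.
- exact: cvg_cst.
Unshelve. all: by end_near. Qed.

Lemma measurable_floor_preimage d (T : measurableType d) (f : T -> R) (c : R)
    (i : int) : measurable_fun setT f ->
  measurable [set w | Num.floor (f w * c) = i].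
Proof.
move=> mf.
have -> : [set w | Num.floor (f w * c) = i] =
    setT `&` (fun w => f w * c) @^-1` `[i%:~R, (i + 1)%:~R[.
  rewrite setTI; apply/seteqP; split => w /=; rewrite in_itv /=.
    by move=> /eqP; rewrite floor_eq.
  by move=> h; apply/eqP; rewrite floor_eq.
by apply: (measurable_funM mf (measurable_cst c)) => //; exact: measurable_itv.
Qed.

Lemma measurable_floor_grid d (T : measurableType d) (f : T -> R) n :
  measurable_fun setT f -> measurable_fun setT (fun w => floor_grid n (f w)).
Proof.
move=> mf; apply: (measurableT_comp _ mf); apply: nondecreasing_measurable => //.
move=> x z xz; rewrite /floor_grid ler_pM2r ?invr_gt0// ler_int.
by apply: le_floor; rewrite ler_pM2r.
Qed.

End Discretization.

(** Countable additivity of the integral of a nonnegative function. It reduces an inequality to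
    cells on which rounded multipliers are constant. *)
Lemma le_integral_countable_partition d (T : measurableType d) (R : realType)
    (mu : {measure set T -> \bar R}) (c : T -> nat) (A : set T)
    (f g : T -> \bar R) :
  measurable A -> (forall k, measurable (A `&` [set w | c w = k])) ->
  measurable_fun A f -> measurable_fun A g ->
  (forall w, A w -> 0 <= f w)%E -> (forall w, A w -> 0 <= g w)%E ->
  (forall k, \int[mu]_(w in A `&` [set w | c w = k]) f w <=
             \int[mu]_(w in A `&` [set w | c w = k]) g w)%E ->
  (\int[mu]_(w in A) f w <= \int[mu]_(w in A) g w)%E.
Proof.
move=> mA mF mf mg f0 g0 fg.
have AE : A = \bigcup_k (A `&` [set w | c w = k]).
  by apply/seteqP; split=> [w Aw|w [k _ []]]//; exists (c w).
have tF : trivIset setT (fun k => A `&` [set w | c w = k]).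
  apply/trivIsetP => i j _ _ ij; apply/seteqP; split=> w //= [[_ ci] [_ cj]].
  by move: ij; rewrite -ci -cj eqxx.
rewrite AE !ge0_integral_bigcup -?AE//.
apply: lee_nneseries => // i _ _.
by apply: integral_ge0 => w [Aw _]; exact: f0.
Qed.

(** * One-step exponential bound *)

Section Step.
Context d (T : measurableType d) (R : realType) (P : {measure set T -> \bar R}).
Variables (G : set (set T)) (sg : R) (eta : T -> R).
Hypothesis G_meas : G `<=` measurable.
Hypothesis eta_meas : measurable_fun setT eta.
Hypothesis eta_subgaussian : forall (lam : R) (A : set T), <<s G>> A ->
  (\int[P]_(w in A) (expR (lam * eta w))%:E <=
   (expR (lam ^+ 2 * sg ^+ 2 / 2))%:E * P A)%E.

Lemma sigma_sub_measurable (A : set T) : <<s G>> A -> measurable A.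
Proof. by apply: smallest_sub => //; exact: sigma_algebra_measurable. Qed.

Lemma measurable_wrt_measurable (f : T -> R) :
  measurable_wrt G f -> measurable_fun setT f.
Proof. by move=> mf _ B mB; apply: sigma_sub_measurable; exact: mf. Qed.

(* [W] and [L] are rounded down to a grid: on each of the countably many cells
   they are constant and [eta_subgaussian] applies; Fatou's lemma then removes
   the rounding. *)
Lemma subgaussian_step (W L : T -> R) (A : set T) :
  measurable_wrt G W -> measurable_wrt G L -> <<s G>> A ->
  (\int[P]_(w in A)
      (expR (W w + (L w * eta w - L w ^+ 2 * sg ^+ 2 / 2)))%:E <=
   \int[P]_(w in A) (expR (W w))%:E)%E.
Proof.
move=> GW GL GA.
have mA := sigma_sub_measurable GA.
have mW := measurable_wrt_measurable GW.
have mL := measurable_wrt_measurable GL.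
pose e (W' L' : T -> R) w : R := W' w + (L' w * eta w - L' w ^+ 2 * sg ^+ 2 / 2).
have me (W' L' : T -> R) : measurable_fun setT W' -> measurable_fun setT L' ->
    measurable_fun A (fun w => (expR (e W' L' w))%:E).
  move=> mW' mL'; apply: (measurable_funS measurableT) => //.
  apply/measurable_EFinP; apply: measurableT_comp => //.
  apply: measurable_funD => //; apply: measurable_funB.
    exact: measurable_funM.
  apply: measurable_funM; last exact: measurable_cst.
  by apply: measurable_funM; [exact: measurable_funX|exact: measurable_cst].
have meW (W' : T -> R) : measurable_fun setT W' ->
    measurable_fun A (fun w => (expR (W' w))%:E).
  move=> mW'; apply: (measurable_funS measurableT) => //.
  by apply/measurable_EFinP; apply: measurableT_comp.
pose Wn n w := floor_grid n (W w); pose Ln n w := floor_grid n (L w).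
have mWn n : measurable_fun setT (Wn n) by exact: measurable_floor_grid.
have mLn n : measurable_fun setT (Ln n) by exact: measurable_floor_grid.
have H n : (\int[P]_(w in A) (expR (e (Wn n) (Ln n) w))%:E <=
            \int[P]_(w in A) (expR (W w))%:E)%E.
  (* The grid value lies below [W], so the bound may be proved with the rounded [W] on both
     sides. *)
  apply: (@le_trans _ _ (\int[P]_(w in A) (expR (Wn n w))%:E)%E); last first.
    apply: ge0_le_integral => //; [exact: meW|exact: meW|].
    by move=> w _; rewrite lee_fin ler_expR floor_grid_le.
  pose c w := pickle (Num.floor (W w * n.+1%:R), Num.floor (L w * n.+1%:R)).
  have GF k : <<s G>> (A `&` [set w | c w = k]).
    (* An index outside the range of [pickle] has an empty cell; any other index fixes both
       floors. *)
    have [[[i j] ijk]|nk] := pselect (exists p : int * int, pickle p = k);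
        last first.
      rewrite (_ : _ `&` _ = set0).
        exact: (@measurable0 _ (g_sigma_algebraType G)).
      apply/seteqP; split => w //= [_ ck]; apply: nk.
      by exists (Num.floor (W w * n.+1%:R), Num.floor (L w * n.+1%:R)).
    rewrite (_ : _ `&` _ = A `&` ([set w | Num.floor (W w * n.+1%:R) = i] `&`
        [set w | Num.floor (L w * n.+1%:R) = j])); last first.
      congr (_ `&` _); apply/seteqP; split => w /=.
        by rewrite -ijk => /(pcan_inj (@pickleK _)) [-> ->].
      by rewrite -ijk /c => -[-> ->].
    apply: (@measurableI _ (g_sigma_algebraType G)) => //.
    by apply: (@measurableI _ (g_sigma_algebraType G)) => //;
      exact: (@measurable_floor_preimage R _ (g_sigma_algebraType G)).
  have mF k := sigma_sub_measurable (GF k).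
  apply: (le_integral_countable_partition (c := c)) => //.
  - exact: me.
  - exact: meW.
  move=> k; set F := A `&` _.
  have [F0|/set0P[w0 [_ cw0]]] := eqVneq F set0.
    by rewrite F0 !integral_set0.
  have cE w : F w -> Wn n w = Wn n w0 /\ Ln n w = Ln n w0.
    move=> [_ /=]; rewrite -cw0 /c => /(pcan_inj (@pickleK _)) [E1 E2].
    by rewrite /Wn /Ln /floor_grid E1 E2.
  set a := Wn n w0 in cE; set l := Ln n w0 in cE.
  (* On the cell the exponent is the constant [a - l^2 sg^2 / 2] plus [l * eta]; the sub-Gaussian
     factor [exp (l^2 sg^2 / 2)] cancels the compensator exactly. *)
  rewrite (@eq_integral _ _ _ P F (fun w => (expR (a - l ^+ 2 * sg ^+ 2 / 2))%:E *
      (expR (l * eta w))%:E)%E); last first.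
    move=> w /set_mem /cE [E1 E2]; rewrite /e E1 E2 -EFinM -expRD.
    by congr (expR _)%:E; ring.
  rewrite [leRHS](@eq_integral _ _ _ P F (cst (expR a)%:E)); last first.
    by move=> w /set_mem /cE [E1 _]; rewrite /cst -E1.
  rewrite integral_cst//; last exact: mF.
  have mE : measurable_fun F (fun w => (expR (l * eta w))%:E).
    apply: (measurable_funS measurableT) => //.
    apply/measurable_EFinP; apply: measurableT_comp => //.
    exact: measurable_funM.
  rewrite (ge0_integralZl P (mF k) mE); last 2 first.
  - by move=> w _; rewrite lee_fin expR_ge0.
  - by rewrite lee_fin expR_ge0.
  apply: (@le_trans _ _ ((expR (a - l ^+ 2 * sg ^+ 2 / 2))%:E *
     ((expR (l ^+ 2 * sg ^+ 2 / 2))%:E * P F))%E).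
    by apply: lee_wpmul2l; [rewrite lee_fin expR_ge0|exact: eta_subgaussian].
  by rewrite muleA -EFinM -expRD subrK.
(* As the mesh tends to 0 the rounded integrands converge pointwise, so the integrand is their lower
   limit and Fatou's lemma applies. *)
rewrite (@eq_integral _ _ _ P A
   (fun w => limn_einf (fun n => (expR (e (Wn n) (Ln n) w))%:E))); last first.
  move=> w _.
  have cW : Wn n w @[n --> \oo] --> W w := @cvg_floor_grid R (W w).
  have cL : Ln n w @[n --> \oo] --> L w := @cvg_floor_grid R (L w).
  have: (expR (e (Wn n) (Ln n) w))%:E @[n --> \oo] --> (expR (e W L w))%:E.
    apply: cvg_EFin; first by near=> n.
    apply: (cvg_comp _ expR); last exact: continuous_expR.
    apply: cvgD => //; apply: cvgB; first by apply: cvgM => //; exact: cvg_cst.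
    apply: cvgM; last exact: cvg_cst.
    by apply: cvgM; [rewrite expr2; exact: cvgM|exact: cvg_cst].
  by move=> /cvg_limn_einf_sup [E1 _]; rewrite -E1.
apply: le_trans; first apply: fatou => // n.
  exact: me.
rewrite limn_einf_lim; apply: lime_le; first exact: is_cvg_einfs.
near=> n; apply: le_trans (H n).
by apply: ereal_inf_lbound; exists n => /=.
Unshelve. all: by end_near. Qed.

End Step.

(** * Maximal inequality *)

Section Ville.
Context d (T : measurableType d) (R : realType) (P : {measure set T -> \bar R}).
Variables (F : nat -> set (set T)) (M : nat -> T -> R) (c : R).
Hypothesis F_meas : forall n, F n `<=` measurable.
Hypothesis F_mono : forall n, F n `<=` F n.+1.
Hypothesis M_adapted : forall n, measurable_wrt (F n) (M n).
Hypothesis M_ge0 : forall n w, 0 <= M n w.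
Hypothesis M_step : forall n (A : set T), <<s F n >> A ->
  (\int[P]_(w in A) (M n.+1 w)%:E <= \int[P]_(w in A) (M n w)%:E)%E.
Hypothesis c_gt0 : 0 < c.

Let S n := [set w | exists2 k, (k <= n)%N & c <= M k w].

Let crossing_measurable n : <<s F n >> [set w | c <= M n w].
Proof.
rewrite (_ : [set w | _] = setT `&` M n @^-1` `[c, +oo[); last first.
  by apply/seteqP; split => w /=; rewrite in_itv /= andbT => //; case.
exact: (@M_adapted n (@measurableT _ (g_sigma_algebraType (F n))) _
  (measurable_itv `[c, +oo[)).
Qed.

Let SS n : S n.+1 = S n `|` [set w | c <= M n.+1 w].
Proof.
apply/seteqP; split => w /=.
  move=> [k]; rewrite leq_eqVlt => /predU1P[-> ?|kn ck]; first by right.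
  by left; exists k.
by move=> [[k kn ck]|?]; [exists k => //; exact: leqW|exists n.+1].
Qed.

Let S_meas n : <<s F n >> (S n).
Proof.
elim: n => [|n IH].
  rewrite (_ : S 0 = [set w | c <= M 0%N w]); first exact: crossing_measurable.
  apply/seteqP; split => w /=; last by exists 0%N.
  by move=> [k]; rewrite leqn0 => /eqP ->.
rewrite SS; apply: (@measurableU _ (g_sigma_algebraType (F n.+1))).
  by apply: sub_sigma_algebra2 IH; exact: F_mono.
exact: crossing_measurable.
Qed.

Let mS n : measurable (S n).
Proof. exact: (sigma_sub_measurable (@F_meas n) (@S_meas n)). Qed.

Let mM n : measurable_fun setT (EFin \o M n).
Proof.
apply/measurable_EFinP.
exact: (measurable_wrt_measurable (@F_meas n) (@M_adapted n)).
Qed.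

Let mMA n A : measurable_fun A (fun w => (M n w)%:E).
Proof. exact: measurable_funS (mM n). Qed.

Let markov n (A : set T) : measurable A -> (forall w, A w -> c <= M n w) ->
  (c%:E * P A <= \int[P]_(w in A) (M n w)%:E)%E.
Proof.
move=> mA cM; rewrite -integral_cst//; apply: ge0_le_integral => //.
by move=> w _; rewrite lee_fin ltW.
Qed.

Let integralU n (A B : set T) : measurable A -> measurable B -> A `&` B = set0 ->
  (\int[P]_(w in A `|` B) (M n w)%:E =
   \int[P]_(w in A) (M n w)%:E + \int[P]_(w in B) (M n w)%:E)%E.
Proof.
move=> mA mB AB; apply: ge0_integral_setU => //; last by apply/disj_set2P.
by move=> w _; rewrite lee_fin.
Qed.

(* Mass of the process stopped at its first crossing, truncated at time [n]. *)
Let ville_finite n :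
  (c%:E * P (S n) + \int[P]_(w in ~` S n) (M n w)%:E <= \int[P]_w (M 0%N w)%:E)%E.
Proof.
elim: n => [|n IH].
  rewrite -[in leRHS](setUv (S 0)) integralU//; last 2 first.
  - exact: measurableC.
  - by rewrite setICr.
  apply: leeD => //; apply: markov => // w [k].
  by rewrite leqn0 => /eqP ->.
apply: le_trans IH.
pose D := S n.+1 `\` S n.
have mD : measurable D by exact: measurableD.
have Dc w : D w -> c <= M n.+1 w.
  by rewrite /D SS => -[[|//]].
have SnS w : S n w -> S n.+1 w by rewrite SS; left.
have DE : S n.+1 = S n `|` D.
  apply/seteqP; split => w; last by move=> [/SnS|[]].
  by move=> Sw; have [|] := pselect (S n w); [left|right].
have -> : P (S n.+1) = (P (S n) + P D)%E.
  by rewrite [in LHS]DE measureU// /D setDE setICA setICr setI0.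
rewrite muleDr// ?ge0_adde_def ?inE// -addeA leeD2l//.
(* Not having crossed by time [n] is an event of [<<s F n>>], so [M_step] applies on it. It splits
   into [D], the first crossings at [n.+1], where Markov's inequality pays for [c * P D], and the
   event of still not having crossed. *)
apply: (@le_trans _ _ (\int[P]_(w in ~` S n) (M n.+1 w)%:E)%E); last first.
  apply: M_step.
  exact: (@measurableC _ (g_sigma_algebraType (F n)) _ (@S_meas n)).
have -> : ~` S n = D `|` ~` S n.+1.
  apply/seteqP; split => w /=.
    by move=> nS; have [|] := pselect (S n.+1 w); [left|right].
  by move=> [[_]//|nS Sw]; apply: nS; exact: SnS.
rewrite integralU//; [|exact: measurableC|]; last first.
  by apply/seteqP; split => w //= [[]].
by apply: leeD => //; exact: markov.
Qed.

(** The bound of [ville_finite] is uniform in [n], its second term is nonnegative, and the events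
    [S n] increase to the event of ever crossing. *)
Lemma ville_inequality :
  (c%:E * P [set w | exists n, (c <= M n w)%R] <= \int[P]_w (M 0%N w)%:E)%E.
Proof.
have -> : [set w | exists n, c <= M n w] = \bigcup_n S n.
  apply/seteqP; split => w /=; first by move=> [n cM]; exists n => //; exists n.
  by move=> [n _ [k _ cM]]; exists k.
have ndS : nondecreasing_seq S.
  move=> n k nk; apply/subsetPset => w [j jn cM]; exists j => //.
  exact: leq_trans nk.
have cv := nondecreasing_cvg_mu (mu := P) mS (bigcupT_measurable _ mS) ndS.
rewrite -(cvg_lim _ cv)// -limeMl//; last first.
  by apply/cvg_ex; exists (P (\bigcup_n S n)).
apply: lime_le.
  by apply: is_cvgeMl => //; apply/cvg_ex; exists (P (\bigcup_n S n)).
near=> n; apply: le_trans (ville_finite n).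
by rewrite leeDl//; apply: integral_ge0 => w _; rewrite lee_fin.
Unshelve. all: by end_near. Qed.

End Ville.

(** * Gaussian mixture supermartingale *)

Section Mixture.
Context d (T : measurableType d) (R : realType) (P : probability T R).
Variables (sg : R).
Hypothesis sg_gt0 : 0 < sg.

(** Closed form, by [gaussian_mixture], of the average of [exp (l S - l^2 sg^2 V / 2)] over
    [l ~ N(0, sg^-2)]. *)
Definition gauss_mix (S V : R) : R :=
  (Num.sqrt (1 + V))^-1 * expR (S ^+ 2 / (2 * sg ^+ 2 * (1 + V))).

Lemma gauss_mix_ge0 S V : 0 <= gauss_mix S V.
Proof. by rewrite mulr_ge0 ?expR_ge0// invr_ge0 sqrtr_ge0. Qed.

Let expo (l S V : R) : R := l * S - l ^+ 2 * sg ^+ 2 / 2 * V.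

(** Tonelli's theorem. [A] enters as an indicator, which makes the integrand jointly measurable on
    the whole product; measurability in [l] serves to compare two such integrals. *)
Lemma integral_gauss_mix (A : set T) (S V : T -> R) : measurable A ->
  measurable_fun setT S -> measurable_fun setT V -> (forall w, 0 <= V w) ->
  (\int[P]_(w in A) (gauss_mix (S w) (V w))%:E =
   \int[lebesgue_measure]_l \int[P]_w
     (\1_A w * (expR (expo l (S w) (V w)) * normal_pdf 0 sg^-1 l))%:E)%E /\
  measurable_fun setT (fun l : measurableTypeR R => \int[P]_w
     (\1_A w * (expR (expo l (S w) (V w)) * normal_pdf 0 sg^-1 l))%:E)%E.
Proof.
move=> mA mS mV V0.
pose f (p : T * measurableTypeR R) : \bar R :=
  (\1_A p.1 * (expR (expo p.2 (S p.1) (V p.1)) * normal_pdf 0 sg^-1 p.2))%:E.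
have mf : measurable_fun setT f.
  apply/measurable_EFinP; apply: measurable_funM.
    by apply: measurableT_comp => //; exact: measurable_indic.
  have m2 : measurable_fun setT (snd : T * measurableTypeR R -> R).
    exact: measurable_snd.
  have mS1 : measurable_fun setT (fun p : T * measurableTypeR R => S p.1).
    exact: (measurableT_comp mS measurable_fst).
  have mV1 : measurable_fun setT (fun p : T * measurableTypeR R => V p.1).
    exact: (measurableT_comp mV measurable_fst).
  apply: measurable_funM; last first.
    exact: (measurableT_comp (measurable_normal_pdf _ _) m2).
  apply: measurableT_comp => //; apply: measurable_funB.
    exact: measurable_funM.
  apply: measurable_funM => //; apply: measurable_funM => //.
  by apply: measurable_funM => //; exact: measurable_funX.
have f0 p : (0 <= f p)%E.
  by rewrite lee_fin !mulr_ge0// ?expR_ge0 ?normal_pdf_ge0.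
split; last exact: (measurable_fun_fubini_tonelli_G (m1 := P) f mf f0).
rewrite -(fubini_tonelli (m1 := P) (m2 := lebesgue_measure) f mf f0).
rewrite integral_mkcond; apply: eq_integral => w _.
rewrite /f /= patchE.
have [wA|wA] := boolP (w \in A); last first.
  rewrite integral0_eq// => l _; by rewrite indicE (negbTE wA) mul0r.
rewrite -gaussian_mixture//.
by apply: eq_integral => l _; rewrite indicE wA mul1r.
Qed.

(** For fixed [l], [subgaussian_step] with multiplier [l * D] gives the inequality for the
    exponential process; integrating against the Gaussian density preserves it. *)
Lemma gauss_mix_step (G : set (set T)) (eta S V D : T -> R) (A : set T) :
  G `<=` measurable -> measurable_fun setT eta ->
  (forall (lam : R) (A : set T), <<s G>> A ->
    (\int[P]_(w in A) (expR (lam * eta w))%:E <=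
     (expR (lam ^+ 2 * sg ^+ 2 / 2))%:E * P A)%E) ->
  measurable_wrt G S -> measurable_wrt G V -> measurable_wrt G D ->
  (forall w, 0 <= V w) -> <<s G>> A ->
  (\int[P]_(w in A) (gauss_mix (S w + D w * eta w) (V w + D w ^+ 2))%:E <=
   \int[P]_(w in A) (gauss_mix (S w) (V w))%:E)%E.
Proof.
move=> GT meta subg GS GV GD V0 GA.
have mA := sigma_sub_measurable GT GA.
have mS := measurable_wrt_measurable GT GS.
have mV := measurable_wrt_measurable GT GV.
have mD := measurable_wrt_measurable GT GD.
have mS' : measurable_fun setT (fun w => S w + D w * eta w).
  by apply: measurable_funD => //; exact: measurable_funM.
have mV' : measurable_fun setT (fun w => V w + D w ^+ 2).
  by apply: measurable_funD => //; exact: measurable_funX.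
have V0' w : 0 <= V w + D w ^+ 2 by rewrite addr_ge0 ?sqr_ge0.
have [-> m1] := integral_gauss_mix mA mS mV V0.
have [-> m2] := integral_gauss_mix mA mS' mV' V0'.
have inner (S1 V1 : T -> R) l :
    measurable_fun setT S1 -> measurable_fun setT V1 ->
    (\int[P]_w
       (\1_A w * (expR (expo l (S1 w) (V1 w)) * normal_pdf 0 sg^-1 l))%:E =
     (normal_pdf 0 sg^-1 l)%:E *
     \int[P]_(w in A) (expR (expo l (S1 w) (V1 w)))%:E)%E.
  move=> mS1 mV1.
  rewrite -ge0_integralZl//; last 2 first.
  - apply: (measurable_funS measurableT) => //.
    apply/measurable_EFinP; apply: measurableT_comp => //.
    by apply: measurable_funB; exact: measurable_funM.
  - by rewrite lee_fin normal_pdf_ge0.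
  rewrite [RHS]integral_mkcond; apply: eq_integral => w _.
  rewrite patchE indicE; case: ifPn => _; last by rewrite mul0r.
  by rewrite mul1r mulrC EFinM.
apply: ge0_le_integral => //.
- move=> l _; apply: integral_ge0 => w _; rewrite lee_fin.
  by rewrite !mulr_ge0// ?expR_ge0 ?normal_pdf_ge0.
- move=> l _; rewrite !inner//.
  apply: lee_wpmul2l; first by rewrite lee_fin normal_pdf_ge0.
  under eq_integral => w _.
    rewrite (_ : expo _ _ _ = expo l (S w) (V w) +
      ((l * D w) * eta w - (l * D w) ^+ 2 * sg ^+ 2 / 2)); last first.
      by rewrite /expo; field.
    over.
  apply: (subgaussian_step GT meta subg) => //.
  + by apply: measurable_funB; apply: measurable_funM.
  + by apply: measurable_funM.
Qed.

End Mixture.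

Lemma gauss_mix_lt (R : realType) (sg S V delta : R) : 0 < sg -> 0 <= V ->
  0 < delta -> gauss_mix sg S V < delta^-1 ->
  S ^+ 2 <= 2 * sg ^+ 2 * (1 + V) * ln (Num.sqrt (1 + V) / delta).
Proof.
move=> sg0 V0 d0; rewrite /gauss_mix.
have V1 : 0 < 1 + V by lra.
have r0 : 0 < Num.sqrt (1 + V) by rewrite sqrtr_gt0.
have k0 : 0 < 2 * sg ^+ 2 * (1 + V) by rewrite !mulr_gt0// exprn_gt0.
rewrite ltr_pdivrMl// -[X in _ < X]lnK ?posrE ?divr_gt0// ltr_expR => h.
by rewrite mulrC -ler_pdivrMr// ltW.
Qed.

(* A form without [_^-1] and [Num.sqrt] of a function, for which the library has
   no measurability lemma. *)
Lemma gauss_mixE (R : realType) (sg S V : R) : 0 < sg -> 0 <= V ->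
  gauss_mix sg S V =
  expR (S ^+ 2 / (2 * sg ^+ 2) * expR (- ln (1 + V)) - ln (1 + V) / 2).
Proof.
move=> sg0 V0; have V1 : 0 < 1 + V by lra.
rewrite /gauss_mix expRD mulrC; congr (_ * _).
  by rewrite expRN lnK ?posrE//; congr expR; field; rewrite !gt_eqF.
rewrite expRN; congr (_^-1); apply/esym/eqP.
rewrite -(@eqrXn2 _ 2)// ?expR_ge0 ?sqrtr_ge0// sqr_sqrtr ?(ltW V1)//.
by rewrite -expRM_natl (_ : _ * _ = ln (1 + V)) ?lnK ?posrE//; field.
Qed.

(** * Self-normalized bound *)

Section Subgaussian.
Context d (T : measurableType d) (R : realType) (P : probability T R).

Lemma integral_prob_cst (r : R) : (\int[P]_w cst r%:E w = r%:E)%E.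
Proof. by rewrite integral_cst//= probability_setT mule1. Qed.

(** Integrating the almost sure bound over an event of the conditioning sigma-algebra trades the
    version [W] for the exponential itself. *)
Lemma cond_subgaussian_integral (G : set (set T)) (sg : R) (eta : T -> R)
    (lam : R) (A : set T) :
  G `<=` measurable -> cond_subgaussian P G sg eta -> <<s G>> A ->
  (\int[P]_(w in A) (expR (lam * eta w))%:E <=
   (expR (lam ^+ 2 * sg ^+ 2 / 2))%:E * P A)%E.
Proof.
move=> GT /(_ lam) [W [_ iW _ WE] Wle] GA.
have mA := sigma_sub_measurable GT GA.
have mW : measurable_fun A W.
  by apply: (measurable_funS measurableT) => //; exact: measurable_int iW.
rewrite -WE// integralE.
(* [W] is not known to be nonnegative pointwise, and the almost everywhere comparison is between
   nonnegative functions. *)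
apply: (@le_trans _ _ (\int[P]_(w in A) W^\+ w)%E).
  rewrite -[leRHS]sube0 leeB//; exact: integral_ge0.
rewrite -integral_cst//; apply: ae_ge0_le_integral => //.
- exact: measurable_funepos.
- by move=> w _; rewrite lee_fin expR_ge0.
- have [N [mN N0 WN]] := Wle; exists N; split=> // w /= h; apply: WN => /= Ww.
  by apply: h => _; rewrite funeposE ge_max Ww lee_fin expR_ge0.
Qed.

(** [exp eta + exp (- eta) - 2] is nonnegative and vanishes only at [eta = 0]; the cases [lam = 1]
    and [lam = -1] make its integral at most 0. *)
Lemma subgaussian0_ae_eq0 (eta : T -> R) : measurable_fun setT eta ->
  (forall lam : R, \int[P]_w (expR (lam * eta w))%:E <= 1)%E ->
  {ae P, forall w, eta w = 0}.
Proof.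
move=> meta le1.
pose f w := expR (eta w) + expR (- eta w) - 2.
have f0 w : 0 <= f w.
  have e0 : 0 < expR (eta w) := expR_gt0 _.
  rewrite /f expRN (_ : _ - 2 = (expR (eta w) - 1) ^+ 2 / expR (eta w)).
    by rewrite divr_ge0 ?sqr_ge0 ?ltW.
  by field; rewrite gt_eqF.
have mexp (g : T -> R) : measurable_fun setT g ->
    measurable_fun setT (fun w => (expR (g w))%:E).
  by move=> mg; apply/measurable_EFinP; exact: measurableT_comp.
have mN : measurable_fun setT (fun w => - eta w) by exact: measurableT_comp.
have mf : measurable_fun setT (fun w => (f w)%:E).
  apply/measurable_EFinP; apply: measurable_funB => //.
  by apply: measurable_funD; apply: measurableT_comp.
have intf : (\int[P]_w `|(f w)%:E| = 0)%E.
  apply/eqP; rewrite eq_le integral_ge0// andbT.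
  under eq_integral => w _ do rewrite gee0_abs ?lee_fin//.
  (* Adding 2 to both sides turns the subtraction into a sum of nonnegative integrals. *)
  rewrite -(@leeD2rE _ 2%:E%E)// add0e.
  rewrite -(integral_prob_cst 2).
  rewrite -ge0_integralD//; last 2 first.
  - by move=> w _; rewrite lee_fin.
  - by move=> w _; rewrite lee_fin.
  have m1 := mexp _ meta; have m2 := mexp _ mN.
  have l1 : (\int[P]_w (expR (eta w))%:E <= 1)%E.
    by have := le1 1; under eq_integral do rewrite mul1r.
  have l2 : (\int[P]_w (expR (- eta w))%:E <= 1)%E.
    by have := le1 (-1); under eq_integral do rewrite mulN1r.
  have e0 (g : T -> R) w : [set: T] w -> (0 <= (expR (g w))%:E)%E.
    by rewrite lee_fin expR_ge0.
  rewrite (@eq_integral _ _ _ P setT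
    (fun w => (expR (eta w))%:E + (expR (- eta w))%:E)%E); last first.
    by move=> w _; rewrite /= -!EFinD /f subrK.
  rewrite (ge0_integralD P measurableT (e0 _) m1 (e0 _) m2) integral_prob_cst.
  by rewrite (_ : 2%:E = 1%:E + 1%:E)%E// leeD.
have [N [mN' N0 fN]] := (ae_eq_integral_abs P measurableT mf).1 intf.
exists N; split=> // w /= h; apply: fN => /= H; apply: h.
have [fw0] : (f w)%:E = 0%:E by exact: H I.
have e0 : 0 < expR (eta w) := expR_gt0 _.
have : (expR (eta w) - 1) ^+ 2 = 0.
  rewrite (_ : _ ^+ 2 = f w * expR (eta w)); first by rewrite fw0 mul0r.
  by rewrite /f expRN; field; rewrite gt_eqF.
move/eqP; rewrite sqrf_eq0 subr_eq0 => /eqP e1.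
by rewrite -[LHS]expRK e1 ln1.
Qed.

Variables (F : nat -> set (set T)) (eta D : nat -> T -> R) (sg delta : R).
Hypothesis F_meas : forall n, F n `<=` measurable.
Hypothesis F_mono : forall n, F n `<=` F n.+1.
Hypothesis eta_adapted : forall n, measurable_wrt (F n.+1) (eta n).
Hypothesis D_predictable : forall n, measurable_wrt (F n) (D n).
Hypothesis eta_subgaussian : forall n, cond_subgaussian P (F n) sg (eta n).

Let S n w := \sum_(s < n) D s w * eta s w.
Let V n w := \sum_(s < n) D s w ^+ 2.

Let wrt_mono n k (f : T -> R) :
  (n <= k)%N -> measurable_wrt (F n) f -> measurable_wrt (F k) f.
Proof.
elim: k => [|k IH]; first by rewrite leqn0 => /eqP ->.
rewrite leq_eqVlt => /predU1P[->//|nk] /(IH nk) mf.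
move=> _ B mB; have H := mf (@measurableT _ (g_sigma_algebraType (F k))) _ mB.
by apply: sub_sigma_algebra2 H; exact: F_mono.
Qed.

Let S_adapted n : measurable_wrt (F n) (S n).
Proof.
apply: measurable_sum => s; apply: measurable_funM.
  by apply: (wrt_mono _ (@D_predictable s)); exact: ltnW.
by apply: (wrt_mono _ (@eta_adapted s)).
Qed.

Let V_adapted n : measurable_wrt (F n) (V n).
Proof.
apply: measurable_sum => s; apply: measurable_funX.
by apply: (wrt_mono _ (@D_predictable s)); exact: ltnW.
Qed.

Let V_ge0 n w : 0 <= V n w.
Proof. by apply: sumr_ge0 => s _; exact: sqr_ge0. Qed.

(** As [D n] is [F n]-measurable, [gauss_mix_step] makes the mixture a supermartingale, and Ville's
    inequality at level [1 / delta] yields one exceptional event for all [n]. *)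
Lemma self_normalized_bound : 0 <= sg -> 0 < delta ->
  exists E : set T, [/\ measurable E, (P E <= delta%:E)%E &
    forall w, ~ E w -> forall n, S n w ^+ 2 <=
      2 * sg ^+ 2 * (1 + V n w) * ln (Num.sqrt (1 + V n w) / delta)].
Proof.
move=> sg_ge0 d0.
have meta n := measurable_wrt_measurable (@F_meas n.+1) (@eta_adapted n).
have subg n (lam : R) (A : set T) := @cond_subgaussian_integral _ sg (eta n) lam A
  (@F_meas n) (@eta_subgaussian n).
(* At [sg = 0] there is no mixing law [N(0, sg^-2)]; there the noise vanishes almost surely and both
   sides are 0. *)
have [sg0|sg_gt0] := eqVneq sg 0.
  have eta0 : {ae P, forall w n, eta n w = 0}.
    apply: ae_foralln => n; apply: subgaussian0_ae_eq0 => // lam.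
    apply: le_trans (subg n lam setT _) _.
      exact: (@measurableT _ (g_sigma_algebraType (F n))).
    by rewrite sg0 expr0n /= mulr0 mul0r expR0 (probability_setT P) mule1.
  have [N [mN N0 etaN]] := eta0; exists N; split=> //.
    by rewrite N0 lee_fin ltW.
  move=> w Nw n; have {}Nw : forall n, eta n w = 0.
    by apply: contrapT => h; apply: Nw; exact: etaN.
  rewrite /S big1 ?expr0n ?sg0 ?expr0n /= ?mulr0 ?mul0r// => s _.
  by rewrite Nw mulr0.
have {sg_ge0}sg_gt0 : 0 < sg by rewrite lt_neqAle eq_sym sg_gt0.
pose M n w := gauss_mix sg (S n w) (V n w).
have M_adapted n : measurable_wrt (F n) (M n).
  have mV := @V_adapted n; have mS := @S_adapted n.
  rewrite (_ : M n = fun w => expR (S n w ^+ 2 / (2 * sg ^+ 2) *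
      expR (- ln (1 + V n w)) - ln (1 + V n w) / 2)); last first.
    by apply/funext => w; rewrite /M gauss_mixE.
  have ml : measurable_wrt (F n) (fun w => ln (1 + V n w)).
    by apply: measurableT_comp => //; exact: measurable_funD.
  apply: measurableT_comp => //; apply: measurable_funB.
    apply: measurable_funM; last first.
      by apply: measurableT_comp => //; exact: measurableT_comp.
    by apply: measurable_funM => //; exact: measurable_funX.
  exact: measurable_funM.
have V1 n w : 0 < 1 + V n w by have := V_ge0 n w; lra.
exists [set w | exists n, delta^-1 <= M n w]; split.
- rewrite (_ : [set w | _] = \bigcup_n (setT `&` M n @^-1` `[delta^-1, +oo[)).
    apply: bigcupT_measurable => n.
    have mM := measurable_wrt_measurable (@F_meas n) (@M_adapted n).
    by apply: mM => //; exact: measurable_itv.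
  apply/seteqP; split => w /=.
    by move=> [n h]; exists n => //=; rewrite in_itv /= h.
  by move=> [n _ [_]]; rewrite /= in_itv /= andbT => h; exists n.
- have := @ville_inequality _ _ _ P F M delta^-1 F_meas F_mono M_adapted.
  (* [S] and [V] are empty sums at time 0, so the mixture starts at 1. *)
  have -> : (\int[P]_w (M 0%N w)%:E = 1)%E.
    rewrite (@eq_integral _ _ _ P setT (cst 1%:E)%E); last first.
      move=> w _; rewrite /M /S /V !big_ord0 /gauss_mix.
      by rewrite addr0 sqrtr1 invr1 mul1r expr0n /= mul0r expR0.
    by rewrite integral_prob_cst.
  move=> ville; rewrite -[leRHS]mule1 -[in leRHS](invrK delta).
  rewrite lee_pdivlMl ?invr_gt0//; apply: ville; rewrite ?invr_gt0//.
    by move=> n w; exact: gauss_mix_ge0.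
  move=> n A FA; under eq_integral => w _.
    rewrite (_ : M n.+1 w = gauss_mix sg (S n w + D n w * eta n w)
      (V n w + D n w ^+ 2)); last by rewrite /M /S /V !big_ord_recr.
    over.
  exact: (gauss_mix_step sg_gt0 (@F_meas n) (meta n) (subg n)).
- move=> w nE n; apply: gauss_mix_lt => //.
  by rewrite ltNge; apply/negP => h; apply: nE; exists n.
Qed.

End Subgaussian.

(** * The bandit model *)

Section Histories.
Context d (T : measurableType d) (R : realType).
Implicit Types (G H : set (set T)) (f : T -> R).

Lemma rv_gen_sub G f : measurable_wrt G f -> rv_gen f `<=` <<s G>>.
Proof.
move=> mf _ [B mB <-].
exact: (mf (@measurableT _ (g_sigma_algebraType G)) _ mB).
Qed.

Lemma measurable_wrt_rv_gen G f : rv_gen f `<=` G -> measurable_wrt G f.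
Proof. by move=> fG _ B mB; apply: sub_sigma_algebra; apply: fG; exists B. Qed.

(** [H] has only to lie in the generated sigma-algebra: past rewards are functions of the generators
    of the noise history, not generators themselves. *)
Lemma measurable_wrt_trans G H f :
  H `<=` <<s G>> -> measurable_wrt H f -> measurable_wrt G f.
Proof.
move=> HG mf _ B mB; have K := mf (@measurableT _ (g_sigma_algebraType H)) _ mB.
apply: (smallest_sub _ HG K); exact: smallest_sigma_algebra.
Qed.

Lemma rv_gen_measurable f : measurable_fun setT f -> rv_gen f `<=` measurable.
Proof. by move=> mf _ [B mB <-]; exact: mf. Qed.

Context (d1 d2 : nat).
Implicit Types X : T -> 'M[R]_(d1, d2).

Lemma mx_gen_measurable X :
  (forall i j, measurable_fun setT (fun w => X w i j)) ->
  mx_gen X `<=` measurable.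
Proof. by move=> mX A [ij _]; apply: rv_gen_measurable. Qed.

Lemma mx_gen_sub G X : (forall i j, measurable_wrt G (fun w => X w i j)) ->
  mx_gen X `<=` <<s G>>.
Proof. by move=> mX A [ij _]; apply: rv_gen_sub. Qed.

Lemma measurable_wrt_mx_gen G X : mx_gen X `<=` G ->
  forall i j, measurable_wrt G (fun w => X w i j).
Proof.
move=> XG i j; apply: measurable_wrt_rv_gen.
by move=> A XA; apply: XG; exists (i, j).
Qed.

Lemma measurable_wrt_mxdot G X (Theta : 'M[R]_(d1, d2)) :
  (forall i j, measurable_wrt G (fun w => X w i j)) ->
  measurable_wrt G (fun w => mxdot (X w) Theta).
Proof.
move=> mX; rewrite (_ : (fun w => _) =
  fun w => \sum_j \sum_i X w i j * Theta i j).
  do 2 (apply: measurable_sum => ?).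
  by apply: measurable_funM; [exact: mX|exact: measurable_cst].
by apply/funext => w; rewrite mxdotE.
Qed.

End Histories.

(** Strong convexity of [m] at [z]: the terms in [mu z] cancel, leaving the quadratic gain and the
    noise times the prediction error. *)
Lemma nll_gap_ge (R : realType) (m mu : R -> R) (Lmu cmu kappa : R)
    (z zhat e : R) : glm_link m mu Lmu cmu kappa ->
  -1 <= z <= 1 -> -1 <= zhat <= 1 ->
  kappa / 2 * (zhat - z) ^+ 2 - (zhat - z) * e <=
  nll m (mu z + e) zhat - nll m (mu z + e) z.
Proof.
move=> hl z1 zh1; have := link_strong_convexity hl z1 zh1.
by rewrite /nll; lra.
Qed.

(** Multiplied by [2 / kappa], the regret inequality fits [log_self_bounded] with [q^2 = 1 + V],
    [a = 2 B / kappa + 1] and [f = sg sqrt (8 / kappa^2)]; [2 a] and [4 f^2] are then the constants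
    of the radius. *)
Lemma sqr_error_bound (R : realType) (kappa sg B S V delta : R) :
  0 < kappa -> 0 <= sg -> 0 < delta <= 4^-1 -> 0 <= V ->
  kappa / 2 * V <= B + S ->
  S ^+ 2 <= 2 * sg ^+ 2 * (1 + V) * ln (Num.sqrt (1 + V) / delta) ->
  1 + V <= 2 + 4 / kappa * B + 32 * sg ^+ 2 / kappa ^+ 2 *
    ln ((sg * Num.sqrt (8 / kappa ^+ 2) + Num.sqrt (2 / kappa * B + 1)) / delta).
Proof.
move=> k0 sg0 hd V0 VB SV.
set f := sg * _; set a := 2 / kappa * B + 1.
have f0 : 0 <= f by rewrite mulr_ge0 ?sqrtr_ge0.
have fE : f ^+ 2 = 8 * sg ^+ 2 / kappa ^+ 2.
  by rewrite exprMn sqr_sqrtr ?divr_ge0 ?sqr_ge0//; field; rewrite gt_eqF.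
clearbody f; have V1 : 0 <= 1 + V by lra.
set q := Num.sqrt (1 + V) in SV.
have qE : q ^+ 2 = 1 + V by rewrite sqr_sqrtr.
have q1 : 1 <= q by rewrite -sqrtr1 ler_wsqrtr//; lra.
set l := ln (q / delta) in SV.
have l0 : 0 <= l.
  move: hd => /andP[d0 d4]; apply: ln_ge0; rewrite ler_pdivlMr//; lra.
have key : q ^+ 2 <= a + f * q * Num.sqrt l.
  (* Compared through squares: [f^2] is [(2 / kappa)^2] times the factor [2 sg^2] of [SV]. *)
  have h : 2 / kappa * S <= f * q * Num.sqrt l.
    have y0 : 0 <= f * q * Num.sqrt l by rewrite !mulr_ge0 ?sqrtr_ge0.
    have : (2 / kappa * S) ^+ 2 <= (f * q * Num.sqrt l) ^+ 2.
      rewrite (exprMn 2 (f * q)) (exprMn 2 f) (sqr_sqrtr l0) fE qE.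
      rewrite (_ : 8 * _ / _ * _ * _ =
        (2 / kappa) ^+ 2 * (2 * sg ^+ 2 * (1 + V) * l)); last first.
        by field; rewrite gt_eqF.
      by rewrite exprMn; apply: ler_wpM2l => //; exact: sqr_ge0.
    by move=> h; rewrite leNgt; apply/negP => h'; nra.
  rewrite qE /a.
  have : 2 / kappa * (kappa / 2 * V) <= 2 / kappa * (B + S).
    by rewrite ler_wpM2l// divr_ge0// ltW.
  rewrite (_ : _ * (_ * V) = V); last by field; rewrite gt_eqF.
  lra.
have := log_self_bounded f0 q1 hd key.
by rewrite qE fE /a; congr (_ <= _ + _ * _); field; rewrite gt_eqF.
Qed.

Theorem lemma12 (R : realType) (d : measure_display) (T : measurableType d)
    (P : probability T R) (nu : {sigma_finite_measure set R -> \bar R})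
    (d1 d2 r : nat)
    (m mu phi : R -> R) (h : R -> R -> R) (tau sg Lmu cmu kappa : R)
    (Theta_star : 'M[R]_(d1, d2)) (X : nat -> T -> 'M[R]_(d1, d2))
    (y eta U yhat : nat -> T -> R) (B : nat -> R) (delta : R)
    (hlink : glm_link m mu Lmu cmu kappa)
    (hrank : \rank Theta_star = r)
    (hsg : 0 <= sg)
    (hmodel : glb_model P nu m mu phi h tau sg Theta_star X y eta U)
    (hpred : online_predictor X y yhat)
    (hregret : {ae P, forall w, forall t : nat,
       (ereal_sup [set (rho_GLB m X y yhat t Theta w)%:E
                  | Theta in [set Theta | (frob Theta <= 1)%R]]
        <= (B t)%:E)%E})
    (hdelta : 0 < delta <= 4^-1) :
  (P [set w | exists t : nat,
        ~ conf_set kappa sg B delta X yhat t w Theta_star] <= delta%:E)%E.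
Proof.
pose G := noise_history X eta.
pose D t w := yhat t w - mxdot (X t w) Theta_star.
have z_itv t w : -1 <= mxdot (X t w) Theta_star <= 1.
  by apply: mxdot_itv1; [exact: (glb_arm hmodel)|exact: (glb_Theta hmodel)].
have G_meas t : G t `<=` measurable.
  move=> A [[s _]|[s _]].
    by apply: mx_gen_measurable; exact: (glb_X_meas hmodel).
  by apply: rv_gen_measurable; exact: (glb_eta_meas hmodel).
have G_mono t : G t `<=` G t.+1.
  move=> A [[s st XA]|[s st EA]]; [left|right]; exists s => //=.
    exact: leqW.
  exact: ltnW.
have X_wrt s t : (s <= t)%N ->
    forall i j, measurable_wrt (G t) (fun w => X s w i j).
  by move=> st; apply: measurable_wrt_mx_gen => A XA; left; exists s.
have eta_wrt s t : (s < t)%N -> measurable_wrt (G t) (eta s).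
  by move=> st; apply: measurable_wrt_rv_gen => A EA; right; exists s.
(* A past reward is a function of arm and noise; on [-1, 1], where the inner product lies, [mu]
   equals its continuous clamped extension. *)
have y_wrt s t : (s < t)%N -> measurable_wrt (G t) (y s).
  move=> st.
  rewrite (_ : y s = fun w =>
      mu (Num.max (-1) (Num.min 1 (mxdot (X s w) Theta_star))) + eta s w).
    apply: measurable_funD; last exact: eta_wrt.
    apply: (measurableT_comp
      (continuous_measurable_fun (link_clamp_continuous hlink))).
    by apply: measurable_wrt_mxdot; exact: X_wrt (ltnW st).
  apply/funext => w; rewrite (glb_reward hmodel).
  by have /andP[z1 z2] := z_itv s w; rewrite min_r// max_r.
(* Predictions depend on past observations and the current arm, all measurable for the noise
   history, so the error is predictable. *)
have D_wrt t : measurable_wrt (G t) (D t).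
  have sub : obs_history X y t `|` mx_gen (X t) `<=` <<s G t>>.
    move=> A [[s /= st [XA|yA]]|XA].
    - by apply: mx_gen_sub XA; exact: X_wrt (ltnW st).
    - by apply: rv_gen_sub yA; exact: y_wrt.
    - by apply: mx_gen_sub XA; exact: X_wrt.
  apply: measurable_funB; last by apply: measurable_wrt_mxdot; exact: X_wrt.
  exact: (measurable_wrt_trans sub (@pred_meas _ _ _ _ _ _ _ _ hpred t)).
have /andP[d0 _] := hdelta.
have [E [mE PE SE]] := self_normalized_bound G_meas G_mono
  (fun n => @eta_wrt n n.+1 (ltnSn n)) D_wrt (glb_noise hmodel) hsg d0.
have [N [mN N0 regretN]] := hregret.
have confE t w : conf_set kappa sg B delta X yhat t w Theta_star =
    (frob Theta_star ^+ 2 + \sum_(s < t) D s w ^+ 2 <=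
     beta_GLB kappa sg B delta t) :> Prop.
  rewrite /conf_set /=; congr (is_true (_ + _ <= _)).
  by apply: eq_bigr => s _; rewrite mxdotC.
(* [E] is where the self-normalized bound may fail, [N] the null set where the regret bound may
   fail; off both the argument is deterministic. *)
have bad_sub :
    [set w | exists t, ~ conf_set kappa sg B delta X yhat t w Theta_star]
      `<=` E `|` N.
  move=> w [t nconf]; have [Ew|nE] := pselect (E w); first by left.
  right; apply: contrapT => nN; apply: nconf.
  have regret : forall t, (ereal_sup [set (rho_GLB m X y yhat t Theta w)%:E
      | Theta in [set Theta | (frob Theta <= 1)%R]] <= (B t)%:E)%E.
    by apply: contrapT => ?; apply: nN; exact: regretN.
  have rhoB : rho_GLB m X y yhat t Theta_star w <= B t.
    rewrite -lee_fin; apply: le_trans (regret t).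
    apply: ereal_sup_ubound; exists Theta_star => //=.
    exact: (glb_Theta hmodel).
  have := SE w nE t.
  set V := \sum_(s < t) D s w ^+ 2; set S := \sum_(s < t) D s w * eta s w => SV.
  have V0 : 0 <= V by apply: sumr_ge0 => s _; exact: sqr_ge0.
  have VB : kappa / 2 * V <= B t + S.
    rewrite -lerBlDr; apply: le_trans rhoB.
    rewrite mulr_sumr -sumrB; apply: ler_sum => s _.
    rewrite (glb_reward hmodel) (mxdotC Theta_star).
    by apply: (nll_gap_ge _ hlink) => //; exact: (pred_range hpred).
  have := sqr_error_bound (link_kappa_gt0 hlink) hsg hdelta V0 VB SV.
  rewrite confE; apply: le_trans.
  (* The 1 in [1 + V] pays for the squared norm of [Theta_star]. *)
  by rewrite lerD2r frob_sqr; apply: frob_le1_sqr; exact: (glb_Theta hmodel).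
apply: (@le_trans _ _ (P (E `|` N))).
  (* Monotonicity needs the bad event measurable: it is a countable union over [t] of events that
     the sum of squared errors exceeds a constant. *)
  apply: le_measure => //; rewrite inE; last exact: measurableU.
  rewrite (_ : [set w | _] = \bigcup_t (setT `&`
      (fun w => \sum_(s < t) D s w ^+ 2) @^-1`
        `]beta_GLB kappa sg B delta t - frob Theta_star ^+ 2, +oo[)).
    apply: bigcupT_measurable => t.
    have mV : measurable_fun setT (fun w => \sum_(s < t) D s w ^+ 2).
      apply: measurable_sum => s; apply: measurable_funX.
      exact: (measurable_wrt_measurable (@G_meas s) (@D_wrt s)).
    by apply: mV => //; exact: measurable_itv.
  apply/seteqP; split => w /=.
    move=> [t]; rewrite confE => /negP; rewrite -ltNge => h'; exists t => //=.
    by split => //; rewrite in_itv /= andbT ltrBlDl.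
  move=> [t _ [_]]; rewrite /= in_itv /= andbT ltrBlDl => h'; exists t.
  by rewrite confE; apply/negP; rewrite -ltNge.
apply: le_trans (measureU2 _ mE mN) _.
by rewrite [X in (_ + X)%E]N0 adde0.
Qed.
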